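(* Let $M$ be a smooth connected manifold, $\mu$ a measure on $M$ and $(P_t)_{t\ge0}$ a semigroup on $L^2(M,\mu)$ satisfying the diffusion axioms, the smooth first-order diffusion calculus and the non-degeneracy condition described in the context, and let $g$ be the recovered Riemannian metric. Then the diffusion semigroup $(P_t)$ uniquely determines the Levi-Civita connection of $g$. That is, if $(\mu,(P_t))$ and $(\tilde\mu,(\tilde P_t))$ are two such data on $M$ with $P_tf=\tilde P_tf$ for all $t\ge0$ and $f\in C^\infty(M)$, then the Levi-Civita connections of the respective recovered metrics coincide.
   Context: Setting. $M$ is a smooth connected manifold, $\mu$ a $\sigma$-finite Borel measure on $M$ with full support, and $(P_t)_{t\ge0}$ a conservative symmetric Markov $C_0$-semigroup on $L^2(M,\mu)$ with self-adjoint generator $L$, $Lf=\lim_{t\downarrow0}(P_tf-f)/t$ in $L^2(\mu)$ for $f\in\mathrm{Dom}(L)$. Its Dirichlet form is $\mathcal E(f,h)=\lim_{t\downarrow0}\frac1t\langle f-P_tf,h\rangle_{L^2(\mu)}$, with domain $\mathcal D(\mathcal E)=\{f\in L^2(\mu):\mathcal E(f,f)<\infty\}$. Diffusion axioms. (D1) $0\le f\le1\Rightarrow0\le P_tf\le1$, and $P_t1=1$. (D2) $\int_M(P_tf)h\,d\mu=\int_Mf\,(P_th)\,d\mu$ for all $f,h\in L^2(M,\mu)$. (D3) Strong locality: $\mathcal E(f,h)=0$ whenever $f$ is constant on a neighbourhood of $\mathrm{supp}(h)$. (D4) Regularity: $\mathcal D(\mathcal E)\cap C_c(M)$ is dense in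 $\mathcal D(\mathcal E)$ for the norm $(\mathcal E(f,f)+\|f\|_{L^2}^2)^{1/2}$ and dense in $C_c(M)$ for the sup norm. (D5) $\mu$ is a smooth positive measure: locally $\mu=\rho\,dx$ with $\rho\in C^\infty$, $\rho>0$. Carré du champ. The semigroup is taken to act on $C^\infty(M)$, and for $f,h\in C^\infty(M)$, $$\Gamma(f,h):=\lim_{t\downarrow0}\frac1{2t}\big(P_t(fh)-(P_tf)(P_th)\big),\qquad \Gamma(f):=\Gamma(f,f).$$ Smooth first-order diffusion calculus. For all $f,h\in C^\infty(M)$ this limit exists pointwise and $\Gamma(f,h)\in C^\infty(M)$; $\Gamma$ is symmetric and bilinear; $\Gamma(f,h)(x)$ depends only on $df(x),dh(x)$; $\Gamma(f,h)=0$ if $h$ is constant near $\mathrm{supp}(f)$; Leibniz rule $\Gamma(f_1f_2,h)=f_1\Gamma(f_2,h)+f_2\Gamma(f_1,h)$, and likewise in the second slot; one-variable chain rule $\Gamma(\phi\circ f,h)=\phi'(f)\Gamma(f,h)$ for every smooth $\phi:\mathbb R\to\mathbb R$, and likewise in the second slot. Non-degeneracy condition. For every $x\in M$ the bilinear form on $T_x^*M$ given by $(df(x),dh(x))\mapsto\Gamma(f,h)(x)$ is positive definite. Recovered metric. The unique smooth Riemannian metric $g$ on $M$ with $\Gamma(f,h)=\langle df,dh\rangle_{g^{-1}}$ for all $f,h\in C^\infty(M)$, where $\langle\cdot,\cdot\rangle_{g^{-1}}$ is the inner product on $T^*M$ dual to $g$. *)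

(* Defs.v *)
From HB Require Import structures.
From mathcomp Require Import all_boot all_order all_algebra.
From mathcomp Require Import all_classical all_reals all_analysis.

Set Implicit Arguments.
Unset Strict Implicit.
Unset Printing Implicit Defensive.

Import Order.TTheory GRing.Theory Num.Theory numFieldNormedType.Exports.

Local Open Scope classical_set_scope.
Local Open Scope ring_scope.

(* Only meaningful when [U] is open.  In finite dimension, quantifying over all
   directions [v] amounts to quantifying over the coordinate directions. *)
Fixpoint Ck (R : realType) (V : normedModType R) (k : nat) (U : set V)
    (f : V -> R) : Prop :=
  if k is k'.+1 then
    (forall x, U x -> differentiable f x) /\ (forall v, Ck k' U ('D_v f))
  else forall x, U x -> {for x, continuous f}.

Definition Coo (R : realType) (V : normedModType R) (U : set V) (f : V -> R) :=
  forall k, Ck k U f.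

Section CkTheory.
Variables (R : realType) (V : normedModType R).
Implicit Types (U : set V) (f g : V -> R).

Lemma near_eq_differentiable f g (x : V) :
  {near x, f =1 g} -> differentiable f x -> differentiable g x.
Proof.
move=> fg df; have fgx : f x = g x by exact: nbhs_singleton fg.
have Eg : g \o shift x = cst (g x) + 'd f x +o_ 0 id.
  apply/eqaddoP => _/posnumP[e].
  have /eqaddoP /(_ e%:num (gt0 _)) := diff_locally df.
  move: (fg); rewrite (near_shift 0) subr0 => fg0.
  apply: filter_app; apply: filterS fg0 => h /= fgh.
  by rewrite !fctE /= -fgx -fgh.
apply/diff_locallyP; rewrite (diff_unique (diff_continuous df) Eg).
by split=> //; exact: diff_continuous.
Qed.

Lemma Ck_ext k U f g : open U -> (forall x, U x -> f x = g x) ->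
  Ck k U f -> Ck k U g.
Proof.
move=> Uo; elim: k f g => [|k IH] f g fg /=.
  move=> Cf x Ux; have nfg : {near x, g =1 f}.
    by apply: filterS (open_nbhs_nbhs (conj Uo Ux)) => y /fg.
  move=> W gW; have nW : nbhs x (f @^-1` W) by apply: Cf => //; rewrite fg.
  by apply: filterS (filterI nfg nW) => y [/= gf Wf]; rewrite /= gf.
have nfg x : U x -> {near x, f =1 g}.
  by move=> Ux; apply: filterS (open_nbhs_nbhs (conj Uo Ux)) => y /fg.
move=> [df Cf]; split=> [x Ux|v].
  by apply: near_eq_differentiable (df _ Ux); exact: nfg.
by apply: IH (Cf v) => x Ux; apply: near_eq_derive; exact: nfg.
Qed.

Lemma Ck_cst k U (a : R) : Ck k U (cst a).
Proof.
elim: k a => [|k IH] a /=; first by move=> x _; exact: cst_continuous.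
split=> [x _|v]; first exact: differentiable_cst.
suff -> : 'D_v (cst a : V -> R) = cst 0 by [].
by apply/funext => x; rewrite derive_cst.
Qed.

Lemma CkW k U f : Ck k.+1 U f -> Ck k U f.
Proof.
elim: k f => [|k IH] f [df Cf].
  by move=> x Ux; apply: differentiable_continuous; exact: df.
by split=> // v; exact: IH.
Qed.

Lemma CkN k U f : open U -> Ck k U f -> Ck k U (- f).
Proof.
move=> Uo; elim: k f => [|k IH] f /= => [Cf x Ux|[df Cf]].
  by apply: continuousN; exact: Cf.
split=> [x Ux|v]; first by apply: differentiableN; exact: df.
apply: Ck_ext (IH _ (Cf v)) => // x Ux.
by rewrite deriveN//; apply: diff_derivable; exact: df.
Qed.

Lemma CkD k U f g : open U -> Ck k U f -> Ck k U g -> Ck k U (f + g).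
Proof.
move=> Uo; elim: k f g => [|k IH] f g /= => [Cf Cg x Ux|[df Cf] [dg Cg]].
  by apply: continuousD; [exact: Cf|exact: Cg].
split=> [x Ux|v]; first by apply: differentiableD; [exact: df|exact: dg].
apply: Ck_ext (IH _ _ (Cf v) (Cg v)) => // x Ux.
by rewrite deriveD//; apply: diff_derivable; [exact: df|exact: dg].
Qed.

Lemma CkM k U f g : open U -> Ck k U f -> Ck k U g -> Ck k U (f * g).
Proof.
move=> Uo; elim: k f g => [|k IH] f g.
  by move=> Cf Cg x Ux; apply: continuousM; [exact: Cf|exact: Cg].
move=> Cf Cg; have [df dCf] := Cf; have [dg dCg] := Cg.
split=> [x Ux|v]; first by apply: differentiableM; [exact: df|exact: dg].
have := CkD Uo (IH _ _ (CkW Cf) (dCg v)) (IH _ _ (CkW Cg) (dCf v)).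
apply: Ck_ext => // x Ux.
by rewrite deriveM//; apply: diff_derivable; [exact: df|exact: dg].
Qed.
End CkTheory.

(* [chart_inv] is only relevant on the open image [chart_cod] of the chart. *)
Record chart (R : realType) (n : nat) (M : topologicalType) := Chart {
  chart_dom : set M ;
  chart_map :> M -> 'rV[R]_n ;
  chart_inv : 'rV[R]_n -> M ;
  chart_dom_open : open chart_dom ;
  chart_cod_open : open (chart_map @` chart_dom) ;
  chart_mapK : forall x, chart_dom x -> chart_inv (chart_map x) = x ;
  chart_map_continuous :
    forall x, chart_dom x -> {for x, continuous chart_map} ;
  chart_inv_continuous :
    forall y, (chart_map @` chart_dom) y -> {for y, continuous chart_inv}
}.

Definition chart_cod R n M (c : chart R n M) : set 'rV[R]_n :=
  c @` chart_dom c.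

(* The atlas need not be maximal: enlarging it by compatible charts changes
   neither smoothness nor tangent vectors below.  The underlying space is
   pointed, i.e. manifolds are nonempty. *)
Record smooth_manifold (R : realType) (n : nat) := SmoothManifold {
  manifold_space :> ptopologicalType ;
  manifold_hausdorff : hausdorff_space manifold_space ;
  manifold_second_countable : @second_countable manifold_space ;
  atlas : set (chart R n manifold_space) ;
  atlas_cover : forall x, exists2 c, atlas c & chart_dom c x ;
  atlas_compatible : forall c c', atlas c -> atlas c' -> forall i : 'I_n,
    Coo (c @` (chart_dom c `&` chart_dom c'))
        (fun y => c' (chart_inv c y) ord0 i)
}.

Section SmoothFunctions.
Variables (R : realType) (n : nat) (M : smooth_manifold R n).

Definition smooth (f : M -> R) : Prop :=
  forall c, atlas c -> Coo (chart_cod c) (f \o chart_inv c).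

Definition cinf_pred : {pred M -> R} := fun f => `[< smooth f >].

Lemma cinf_predP f : reflect (smooth f) (f \in cinf_pred).
Proof. exact: asboolP. Qed.

Lemma cinf_subring_closed : subring_closed cinf_pred.
Proof.
split=> [|f h /cinf_predP sf /cinf_predP sh|f h /cinf_predP sf /cinf_predP sh];
  apply/cinf_predP => c cA k.
- exact: (@Ck_cst _ _ _ _ 1).
- have Dfh := CkD (@chart_cod_open _ _ _ c) (sf c cA k)
                 (CkN (@chart_cod_open _ _ _ c) (sh c cA k)).
  exact: Dfh.
- have Mfh := CkM (@chart_cod_open _ _ _ c) (sf c cA k) (sh c cA k).
  exact: Mfh.
Qed.

HB.instance Definition _ :=
  GRing.isSubringClosed.Build (M -> R) cinf_pred cinf_subring_closed.

(* The ring C^oo(M). *)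
Record cinf := Cinf { cinf_fun :> M -> R ; _ : cinf_fun \in cinf_pred }.

HB.instance Definition _ := [isSub for cinf_fun].
HB.instance Definition _ := [Choice of cinf by <:].
HB.instance Definition _ :=
  GRing.SubChoice_isSubComPzRing.Build (M -> R) cinf_pred cinf
    cinf_subring_closed.

Definition closed_support (f : M -> R) : set M := closure [set x | f x != 0].

Definition locally_constant_near (f : M -> R) (A : set M) : Prop :=
  exists U : set M, exists a : R,
    [/\ open U, A `<=` U & forall x, U x -> f x = a].

End SmoothFunctions.

Section Riemannian.
Variables (R : realType) (n : nat) (M : smooth_manifold R n).
Local Notation cinf := (cinf M).

(* A tangent vector is identified with the directional derivative it defines
   on C^oo(M). *)
Definition coord_vector (c : chart R n M) (x : M) (a : 'rV[R]_n) : cinf -> R :=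
  fun f => 'D_a (f \o chart_inv c) (c x).

(* Requiring a coordinate expression in every chart around [x] is the same as
   requiring it in one of them, by the chain rule. *)
Definition tangent (x : M) : set (cinf -> R) :=
  [set v | forall c, atlas c -> chart_dom c x ->
           exists a, v = coord_vector c x a].

Definition differential (f : cinf) (x : M) : (cinf -> R) -> R := fun v => v f.

(* Covectors at [x] are functionals on the tangent space; their values outside
   [tangent x] are irrelevant. *)
Definition eq_covector (x : M) (a b : (cinf -> R) -> R) : Prop :=
  forall v, tangent x v -> a v = b v.

(* A smooth vector field is the operator f |-> X f that it induces. *)
Definition at_point (X : cinf -> cinf) (x : M) : cinf -> R := fun f => X f x.

Definition vector_field (X : cinf -> cinf) : Prop :=
  forall x, tangent x (at_point X x).

Definition scale_field (f : cinf) (X : cinf -> cinf) : cinf -> cinf :=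
  fun h => f * X h.

Definition lie_bracket (X Y : cinf -> cinf) : cinf -> cinf :=
  fun f => X (Y f) - Y (X f).

Definition tensor2 := M -> (cinf -> R) -> (cinf -> R) -> R.

Record riemannian_metric (g : tensor2) : Prop := {
  metric_linear : forall x a u v w, tangent x u -> tangent x v ->
    tangent x w -> g x (a *: u + v) w = a * g x u w + g x v w ;
  metric_sym : forall x u v, tangent x u -> tangent x v -> g x u v = g x v u ;
  metric_posdef : forall x u, tangent x u -> u != 0 -> 0 < g x u u ;
  metric_smooth : forall X Y, vector_field X -> vector_field Y ->
    smooth (fun x => g x (at_point X x) (at_point Y x))
}.

(* The tangent vector representing a covector through [g]. *)
Definition sharp (g : tensor2) (x : M) (a : (cinf -> R) -> R) : cinf -> R :=
  xget 0 [set u | tangent x u /\ eq_covector x (g x u) a].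

Definition dual_metric (g : tensor2) (x : M) (a b : (cinf -> R) -> R) : R :=
  g x (sharp g x a) (sharp g x b).

Record levi_civita (g : tensor2)
    (nabla : (cinf -> cinf) -> (cinf -> cinf) -> (cinf -> cinf)) : Prop := {
  nabla_field : forall X Y, vector_field X -> vector_field Y ->
    vector_field (nabla X Y) ;
  nabla_addl : forall X X' Y, vector_field X -> vector_field X' ->
    vector_field Y -> nabla (X + X') Y = nabla X Y + nabla X' Y ;
  nabla_scalel : forall f X Y, vector_field X -> vector_field Y ->
    nabla (scale_field f X) Y = scale_field f (nabla X Y) ;
  nabla_addr : forall X Y Y', vector_field X -> vector_field Y ->
    vector_field Y' -> nabla X (Y + Y') = nabla X Y + nabla X Y' ;
  nabla_leibniz : forall f X Y, vector_field X -> vector_field Y ->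
    nabla X (scale_field f Y)
    = scale_field (X f) Y + scale_field f (nabla X Y) ;
  nabla_torsion_free : forall X Y, vector_field X -> vector_field Y ->
    nabla X Y - nabla Y X = lie_bracket X Y ;
  nabla_metric : forall X Y Z (k : cinf), vector_field X -> vector_field Y ->
    vector_field Z ->
    (forall x, k x = g x (at_point Y x) (at_point Z x)) ->
    forall x, X k x = g x (at_point (nabla X Y) x) (at_point Z x)
                    + g x (at_point Y x) (at_point (nabla X Z) x)
}.

End Riemannian.

Notation borel T := (g_sigma_algebraType (@open T)).

(* The Lebesgue measure of R^n is the only Borel measure with these values. *)
Definition is_lebesgue (R : realType) (n : nat)
    (lambda : {measure set (borel 'rV[R]_n) -> \bar R}) : Prop :=
  forall a b : 'rV[R]_n, (forall i, a ord0 i <= b ord0 i) ->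
    lambda [set y | forall i, a ord0 i < y ord0 i <= b ord0 i]
    = (\prod_(i < n) (b ord0 i - a ord0 i))%:E.

Section Diffusion.
Variables (R : realType) (n : nat) (M : smooth_manifold R n).
Variable mu : {measure set (borel M) -> \bar R}.
(* [P t f] is defined for raw functions; only its restrictions to L^2, to
   bounded measurable functions (both modulo null sets) and to C^oo(M)
   (pointwise) are ever constrained. *)
Variable P : R -> (M -> R) -> (M -> R).

Definition measurable_real (f : M -> R) : Prop :=
  measurable_fun [set: borel M] (f : borel M -> R).

Definition L2 : set (M -> R) :=
  [set f | (f : borel M -> R) \in Lfun mu 2%:E].

Definition L2_norm (f : M -> R) : \bar R :=
  'N[mu]_2%:E [(fun x : borel M => (f x)%:E)].

Definition L2_inner (f h : M -> R) : R := (\int[mu]_x (f x * h x))%R.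

Record C0_semigroup : Prop := {
  semigroup_L2 : forall (t : R) f, 0 <= t -> L2 f -> L2 (P t f) ;
  semigroup_ae : forall (t : R) f h, 0 <= t -> L2 f -> L2 h ->
    {ae mu, forall x, f x = h x} -> {ae mu, forall x, P t f x = P t h x} ;
  semigroup_linear : forall (t : R) a f h, 0 <= t -> L2 f -> L2 h ->
    {ae mu, forall x, P t (a *: f + h) x = a * P t f x + P t h x} ;
  semigroup_bounded : forall t : R, 0 <= t -> exists C : R, forall f, L2 f ->
    (L2_norm (P t f) <= C%:E * L2_norm f)%E ;
  semigroup_0 : forall f, L2 f -> {ae mu, forall x, P 0 f x = f x} ;
  semigroup_D : forall (s t : R) f, 0 <= s -> 0 <= t -> L2 f ->
    {ae mu, forall x, P (s + t) f x = P s (P t f) x} ;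
  semigroup_continuous : forall f, L2 f ->
    L2_norm (P t f - f) @[t --> 0^'+] --> 0%E
}.

(* [generator f u] : f is in Dom(L) and L f = u. *)
Definition generator (f u : M -> R) : Prop :=
  [/\ L2 f, L2 u & L2_norm (t^-1 *: (P t f - f) - u) @[t --> 0^'+] --> 0%E].

(* Densely defined, and equal to its adjoint (compared as graphs). *)
Definition self_adjoint_generator : Prop :=
  (forall f, L2 f -> forall e : R, 0 < e ->
     exists h, exists u, generator h u /\ (L2_norm (f - h)%R < e%:E)%E) /\
  (forall f w, L2 f -> L2 w ->
     generator f w <->
     forall h u, generator h u -> L2_inner u f = L2_inner h w).

Definition energy_quotient (f h : M -> R) (t : R) : R :=
  t^-1 * L2_inner (f - P t f) h.

Definition dirichlet (f h : M -> R) : R :=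
  lim (energy_quotient f h t @[t --> 0^'+]).

(* For f in L^2 the nonnegative quotient is monotone in [t], so E(f,f) is
   finite exactly when it converges to a real number. *)
Definition dirichlet_dom : set (M -> R) :=
  [set f | L2 f /\ cvg (energy_quotient f f t @[t --> 0^'+])].

(* P_t on bounded functions (in particular on the constant 1, which is not in
   L^2 when mu is infinite) is the monotone extension of P_t on L^2. *)
Definition monotone_extension : Prop :=
  forall (t : R) (f_ : nat -> M -> R) (f : M -> R), 0 <= t ->
    (forall k, L2 (f_ k)) -> measurable_real f ->
    (exists C : R, {ae mu, forall x, `|f x| <= C}) ->
    {ae mu, forall x, (forall k, 0 <= f_ k x <= f_ k.+1 x) /\
                      f_ ^~ x @ \oo --> f x} ->
    {ae mu, forall x, (P t (f_ k) x @[k --> \oo]) --> P t f x}.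

Definition markov_conservative : Prop :=
  (forall (t : R) f, 0 <= t -> measurable_real f ->
     {ae mu, forall x, 0 <= f x <= 1} ->
     {ae mu, forall x, 0 <= P t f x <= 1}) /\
  (forall t : R, 0 <= t -> P t (cst 1) = cst 1).

Definition symmetric_semigroup : Prop :=
  forall (t : R) f h, 0 <= t -> L2 f -> L2 h ->
    L2_inner (P t f) h = L2_inner f (P t h).

(* The support of a function defined modulo null sets. *)
Definition ae_support (h : M -> R) : set M :=
  ~` \bigcup_(U in [set U : set M |
                     open U /\ {ae mu, forall x, U x -> h x = 0}]) U.

Definition strongly_local : Prop :=
  forall f h, dirichlet_dom f -> dirichlet_dom h ->
    (exists U : set M, exists a : R, [/\ open U, ae_support h `<=` U &
       {ae mu, forall x, U x -> f x = a}]) ->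
    dirichlet f h = 0.

Definition Cc : set (M -> R) :=
  [set f | continuous f /\ compact (closed_support f)].

Definition regular_form : Prop :=
  (forall f, dirichlet_dom f -> forall e : R, 0 < e ->
     exists u, [/\ dirichlet_dom u, Cc u &
       Num.sqrt (dirichlet (f - u) (f - u) + L2_inner (f - u) (f - u)) < e]) /\
  (forall f, Cc f -> forall e : R, 0 < e ->
     exists u, [/\ dirichlet_dom u, Cc u & forall x, `|f x - u x| < e]).

Definition smooth_positive_measure : Prop :=
  forall c : chart R n M, atlas c ->
    exists rho : 'rV[R]_n -> R,
    exists lambda : {measure set (borel 'rV[R]_n) -> \bar R},
    [/\ Coo (chart_cod c) rho,
        forall y, chart_cod c y -> 0 < rho y,
        is_lebesgue lambda &
        forall A : set (borel M), measurable A -> A `<=` chart_dom c ->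
          mu A = (\int[lambda]_(y in (c @` A : set (borel 'rV[R]_n)))
                    (rho y)%:E)%E].

Record smooth_action : Prop := {
  action_smooth : forall (t : R) f, 0 <= t -> smooth f -> smooth (P t f) ;
  action_linear : forall (t : R) a f h, 0 <= t -> smooth f -> smooth h ->
    P t (a *: f + h) = a *: P t f + P t h ;
  action_0 : forall f, smooth f -> P 0 f = f ;
  action_D : forall (s t : R) f, 0 <= s -> 0 <= t -> smooth f ->
    P (s + t) f = P s (P t f)
}.

Record diffusion_axioms : Prop := {
  diffusion_sigma_finite : sigma_finite [set: borel M] mu ;
  diffusion_full_support : forall U : set M, open U -> U !=set0 ->
    (0 < mu U)%E ;
  diffusion_C0_semigroup : C0_semigroup ;
  diffusion_self_adjoint : self_adjoint_generator ;
  diffusion_extension : monotone_extension ;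
  diffusion_action : smooth_action ;
  diffusion_markov : markov_conservative ;
  diffusion_symmetric : symmetric_semigroup ;
  diffusion_local : strongly_local ;
  diffusion_regular : regular_form ;
  diffusion_measure : smooth_positive_measure
}.

Definition Gamma_quotient (f h : M -> R) (x : M) (t : R) : R :=
  (2 * t)^-1 * (P t (f * h) x - P t f x * P t h x).

Definition Gamma (f h : M -> R) : M -> R :=
  fun x => lim (Gamma_quotient f h x t @[t --> 0^'+]).

Record first_order_calculus : Prop := {
  Gamma_cvg : forall f h x, smooth f -> smooth h ->
    cvg (Gamma_quotient f h x t @[t --> 0^'+]) ;
  Gamma_smooth : forall f h, smooth f -> smooth h -> smooth (Gamma f h) ;
  Gamma_sym : forall f h, smooth f -> smooth h -> Gamma f h = Gamma h f ;
  Gamma_linearl : forall a f1 f2 h, smooth f1 -> smooth f2 -> smooth h ->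
    Gamma (a *: f1 + f2) h = a *: Gamma f1 h + Gamma f2 h ;
  Gamma_linearr : forall a f h1 h2, smooth f -> smooth h1 -> smooth h2 ->
    Gamma f (a *: h1 + h2) = a *: Gamma f h1 + Gamma f h2 ;
  Gamma_differential : forall (f f' h h' : cinf M) x,
    eq_covector x (differential f x) (differential f' x) ->
    eq_covector x (differential h x) (differential h' x) ->
    Gamma f h x = Gamma f' h' x ;
  Gamma_local : forall f h, smooth f -> smooth h ->
    locally_constant_near h (closed_support f) -> Gamma f h = cst 0 ;
  Gamma_leibnizl : forall f1 f2 h, smooth f1 -> smooth f2 -> smooth h ->
    Gamma (f1 * f2) h = f1 * Gamma f2 h + f2 * Gamma f1 h ;
  Gamma_leibnizr : forall f h1 h2, smooth f -> smooth h1 -> smooth h2 ->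
    Gamma f (h1 * h2) = h1 * Gamma f h2 + h2 * Gamma f h1 ;
  Gamma_chainl : forall (phi : R -> R) f h, Coo [set: R] phi ->
    smooth f -> smooth h ->
    Gamma (phi \o f) h = (derive1 phi \o f) * Gamma f h ;
  Gamma_chainr : forall (phi : R -> R) f h, Coo [set: R] phi ->
    smooth f -> smooth h ->
    Gamma f (phi \o h) = (derive1 phi \o h) * Gamma f h
}.

(* Every covector at [x] is of the form df(x), and Gamma(f,h)(x) only depends
   on df(x) and dh(x). *)
Definition nondegenerate_Gamma : Prop :=
  forall x (f : cinf M), ~ eq_covector x (differential f x) (fun=> 0) ->
    0 < Gamma f f x.

Definition recovered_metric (g : tensor2 M) : Prop :=
  riemannian_metric g /\
  forall (f h : cinf M) x,
    Gamma f h x = dual_metric g x (differential f x) (differential h x).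

End Diffusion.

(* Main.v *)
(* Gamma is computed from P_t on smooth functions alone, so the two data have
   the same Gamma.  Since Gamma f h x is the derivative of f along the gradient
   of h at x, and every tangent vector is a gradient, the two recovered metrics
   agree; a metric has at most one Levi-Civita connection. *)
Require Import Defs.
From HB Require Import structures.
From mathcomp Require Import all_boot all_order all_algebra.
From mathcomp Require Import all_classical all_reals all_analysis.
From mathcomp Require Import lra.

Import Order.TTheory GRing.Theory Num.Theory numFieldNormedType.Exports.

Local Open Scope classical_set_scope.
Local Open Scope ring_scope.

(** * Linear algebra: spanning rows and solvability *)

(** Choose rows from [S] with maximal rank: appending a further element of [S] cannot raise the
    rank, so that element already lies in the row space. *)
Lemma row_span_of_set (F : fieldType) (n : nat) (S : set 'rV[F]_n) :
  exists m (B : 'M[F]_(m, n)),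
    (forall i, S (row i B)) /\ (forall v, S v -> (v <= B)%MS).
Proof.
pose p k := `[< exists m (B : 'M[F]_(m, n)),
  (forall i, S (row i B)) /\ \rank B = k >].
have exp : exists k, p k.
  exists 0%N; apply/asboolP; exists 0%N, 0; split=> [[]//|].
  exact: mxrank0.
have bp k : p k -> (k <= n)%N.
  by move=> /asboolP[m [B [_ <-]]]; exact: rank_leq_col.
have [k /asboolP[m [B [SB rB]]] kmax] := ex_maxnP exp bp.
exists m, B; split=> // v Sv.
have /kmax : p (\rank (col_mx v B)).
  apply/asboolP; exists (1 + m)%N, (col_mx v B); split=> // i.
  case: (split_ordP i) => j ->; last by rewrite rowKd.
  by rewrite rowKu ord1 row_id.
rewrite -rB => le_rank.
have sBv : (B <= col_mx v B)%MS by rewrite -addsmxE addsmxSr.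
have := mxrank_leqif_sup sBv; case=> le_rank' /esym.
rewrite [X in _ = X]eqn_leq le_rank' le_rank /= => sub.
by apply: submx_trans sub; rewrite -addsmxE addsmxSl.
Qed.

(** Duality: the rows of the transposed cokernel of [A^T] annihilate [A], hence [L], which puts [L]
    in the column space of [A]. *)
Lemma mulmx_solvable (F : fieldType) (m p : nat) (A : 'M[F]_(m, p))
    (L : 'cV[F]_m) :
  (forall u : 'rV_m, u *m A = 0 -> u *m L = 0) -> exists b, L = A *m b.
Proof.
move=> kerA.
have /submxP[b Lb] : (L^T <= A^T)%MS.
  rewrite submxE -[X in X == 0]trmxK trmx_mul trmxK trmx_eq0.
  apply/eqP/row_matrixP => i; rewrite row_mul row0; apply: kerA.
  rewrite -row_mul -[X in row _ (_ *m X)]trmxK -trmx_mul mulmx_coker.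
  by rewrite trmx0 row0.
by exists b^T; rewrite -[LHS]trmxK Lb trmx_mul trmxK.
Qed.

Section Smooth.
Set Implicit Arguments.
Unset Strict Implicit.
Context {R : realType} {n : nat} {M : smooth_manifold R n}.
Implicit Types (x : M) (f h : cinf M) (u v w : cinf M -> R) (g : tensor2 M).

(** * Tangent vectors as functionals on smooth functions *)

Lemma cinf_smooth f : smooth f.
Proof. by case: f => f fP; exact/cinf_predP. Qed.

Lemma smooth_mul (f h : M -> R) : smooth f -> smooth h -> smooth (f * h).
Proof. by move=> /cinf_predP sf /cinf_predP sh; exact/cinf_predP/rpredM. Qed.

Lemma smooth_cst (k : R) : smooth (cst k : M -> R).
Proof. by move=> c _ j; exact: (@Ck_cst _ _ _ _ k). Qed.

(** [cinf M] carries only a ring structure, so scaling by a real is written as a product with a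
    constant. *)
Definition cinf_cst (k : R) : cinf M :=
  Cinf (introT (cinf_predP _) (smooth_cst k)).

Lemma chart_cod_mem (c : chart R n M) x : chart_dom c x -> chart_cod c (c x).
Proof. by exists x. Qed.

Lemma differentiable_chart f c x : atlas c -> chart_dom c x ->
  differentiable (f \o chart_inv c) (c x).
Proof.
move=> cA cx; have [df _] := cinf_smooth f cA 1%N.
exact/df/chart_cod_mem.
Qed.

Lemma coord_vectorP c x a b k : atlas c -> chart_dom c x ->
  coord_vector c x (k *: a + b) = k *: coord_vector c x a + coord_vector c x b.
Proof.
move=> cA cx; apply/funext => f; have df := differentiable_chart f cA cx.
by rewrite /coord_vector !fctE !deriveE// linearP.
Qed.

Lemma coord_vector_linear c x a k f h : atlas c -> chart_dom c x ->
  coord_vector c x a (cinf_cst k * f + h) =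
  k * coord_vector c x a f + coord_vector c x a h.
Proof.
move=> cA cx; have df := differentiable_chart f cA cx.
have dh := differentiable_chart h cA cx.
rewrite /coord_vector.
have -> : (cinf_cst k * f + h : cinf M) \o chart_inv c =
  k *: (f \o chart_inv c) + (h \o chart_inv c) by [].
by rewrite deriveD ?deriveZ//; apply: diff_derivable => //; exact: differentiableZ.
Qed.

Lemma tangentP x u v k : tangent x u -> tangent x v -> tangent x (k *: u + v).
Proof.
move=> tu tv c cA cx; have [a ->] := tu c cA cx; have [b ->] := tv c cA cx.
by exists (k *: a + b); rewrite coord_vectorP.
Qed.

Lemma tangent0 x : tangent x 0.
Proof.
move=> c cA cx; exists 0; apply/funext => f.
rewrite /coord_vector deriveE ?linear0//; exact: differentiable_chart.
Qed.

Arguments tangent0 : clear implicits.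

Lemma tangentB x u v : tangent x u -> tangent x v -> tangent x (u - v).
Proof. by move=> tu tv; rewrite addrC -scaleN1r; exact: tangentP. Qed.

Lemma tangent_linear x v k f h : tangent x v ->
  v (cinf_cst k * f + h) = k * v f + v h.
Proof.
move=> tv; have [c cA cx] := atlas_cover x.
by have [a ->] := tv c cA cx; exact: coord_vector_linear.
Qed.

Lemma tangent_sum x v p (b : 'I_p -> R) (f_ : 'I_p -> cinf M) : tangent x v ->
  v (\sum_i cinf_cst (b i) * f_ i) = \sum_i b i * v (f_ i).
Proof.
move=> tv; elim/big_rec2: _ => [|i y1 y2 _ <-]; last exact: tangent_linear tv.
by have := tangent_linear 1 0 0 tv; rewrite mulr0 addr0; lra.
Qed.

(* Tangent vectors are functions on C^oo(M) lying in a finite-dimensional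
   space, so finitely many evaluations separate them; no bump function is
   needed. *)
Lemma tangent_functional x (l : (cinf M -> R) -> R) :
  (forall k u v, tangent x u -> tangent x v -> l (k *: u + v) = k * l u + l v) ->
  exists h, forall v, tangent x v -> l v = v h.
Proof.
move=> llin; have [c cA cx] := atlas_cover x.
have l0 : l 0 = 0.
  by have := llin 1 0 0 (tangent0 x) (tangent0 x); rewrite scaler0 addr0; lra.
pose ph : 'rV[R]_n -> cinf M -> R := coord_vector c x.
have phP k a b : ph (k *: a + b) = k *: ph a + ph b by exact: coord_vectorP.
have ph0 : ph 0 = 0.
  by apply/funext => f; rewrite /ph /coord_vector deriveE ?linear0//;
     exact: differentiable_chart.
have ph_sum m (a : 'I_m -> R) (r : 'I_m -> 'rV[R]_n) :
    ph (\sum_i a i *: r i) = \sum_i a i *: ph (r i).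
  by elim/big_rec2: _ => [//|i y1 y2 _ <-]; exact: phP.
(* [Fv f] lists the partial derivatives of [f] at [c x]. *)
pose Fv (f : cinf M) : 'rV[R]_n := \row_j ph (delta_mx 0 j) f.
have phF a f : ph a f = (a *m (Fv f)^T) 0 0.
  rewrite {1}(row_sum_delta a) ph_sum mxE fct_sumE.
  by apply: eq_bigr => i _; rewrite !mxE.
(* Since [tangent] quantifies over all charts, not every [a] is known to give a tangent vector; [B]
   spans those that do. *)
have [m [B [SB spanB]]] := @row_span_of_set _ _ [set a | tangent x (ph a)].
have [p [A [SA spanA]]] := @row_span_of_set _ _ (range Fv).
have /choice[f_ Af] : forall i, exists f, Fv f = row i A.
  by move=> i; have [f _ <-] := SA i; exists f.
have tB (u : 'rV[R]_m) : tangent x (ph (u *m B)) /\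
    l (ph (u *m B)) = (u *m \col_i l (ph (row i B))) 0 0.
  rewrite mulmx_sum_row ph_sum mxE.
  elim/big_rec2: _ => [|i y1 y2 _ [ty <-]]; first by split=> //; exact: tangent0.
  by rewrite mxE; split; [exact: tangentP (SB i) ty|rewrite llin//; exact: SB].
have [u uBA0|b Lb] := @mulmx_solvable _ _ _ (B *m A^T) (\col_i l (ph (row i B))).
  apply/matrixP => i j; rewrite !ord1 -(tB u).2.
  (* This vector kills every [f_ i], and their gradients span all gradients, so it vanishes on all
     of C^oo(M). *)
  suff -> : ph (u *m B) = 0 by rewrite l0 mxE.
  apply/funext => f; rewrite phF.
  have /submxP[e ->] : (Fv f <= A)%MS by apply: spanA; exists f.
  by rewrite trmx_mul mulmxA -(mulmxA u) uBA0 mul0mx mxE.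
(* By the choice of [b], evaluation at this function agrees with [l] on the rows of [B], hence on
   all tangent vectors. *)
exists (\sum_i cinf_cst (b i 0) * f_ i) => v tv.
have [a va] := tv c cA cx.
have tphB : [set a | tangent x (ph a)] a by rewrite /= /ph -va.
have /submxP[u ua] := spanB _ tphB.
rewrite (tangent_sum (b ^~ 0) f_ tv) va -/(ph a) ua (tB u).2 Lb !mulmxA mxE.
apply: eq_bigr => i _; rewrite phF Af mulrC; congr (_ * _).
by rewrite !mxE; apply: eq_bigr => j _; rewrite !mxE.
Qed.

(** * Gradients with respect to a metric *)

Section Metric.
Variable g : tensor2 M.
Hypothesis gR : riemannian_metric g.

Lemma metric0l x w : tangent x w -> g x 0 w = 0.
Proof.
move=> tw; have := metric_linear gR 1 (tangent0 x) (tangent0 x) tw.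
by rewrite scaler0 addr0; lra.
Qed.

Lemma metricBl x u v w : tangent x u -> tangent x v -> tangent x w ->
  g x (u - v) w = g x u w - g x v w.
Proof.
move=> tu tv tw; rewrite addrC -scaleN1r (metric_linear gR)// mulN1r.
by rewrite addrC.
Qed.

Lemma metric_eq0 x u : tangent x u -> g x u u = 0 -> u = 0.
Proof.
move=> tu gu; apply/eqP; apply: contraPT (metric_posdef gR tu) => u0.
by move=> /(_ u0); rewrite gu ltxx.
Qed.

Lemma metric_representative_unique x u v :
  tangent x u -> tangent x v ->
  (forall w, tangent x w -> g x u w = g x v w) -> u = v.
Proof.
move=> tu tv uv; apply: subr0_eq; have tuv := tangentB tu tv.
by apply: (metric_eq0 tuv); rewrite metricBl// uv// subrr.
Qed.

(* If no representative existed, [sharp] would be the junk value 0 and the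
   energy Gamma f f x would vanish: non-degeneracy thus replaces the Riesz
   representation theorem. *)
Lemma sharp_spec P : nondegenerate_Gamma P -> recovered_metric P g ->
  forall x f, tangent x (sharp g x (differential f x)) /\
    forall v, tangent x v -> g x (sharp g x (differential f x)) v = v f.
Proof.
move=> nd [_ gP] x f; rewrite /sharp; case: xgetP => [u _ [tu]//|none].
split; first exact: tangent0.
(* Once df vanishes at [x], the default value 0 does represent it. *)
suff df0 : eq_covector x (differential f x) (fun=> 0).
  by move=> v tv; rewrite metric0l//; exact/esym/df0.
apply: contrapT => /nd; rewrite gP /dual_metric /sharp xgetPN//.
by rewrite metric0l ?ltxx//; exact: tangent0.
Qed.

(** Lowering the index of [w] gives a linear functional, which is evaluation at some [f]; its
    gradient is then [w]. *)
Lemma sharp_surjective P : nondegenerate_Gamma P -> recovered_metric P g ->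
  forall x w, tangent x w -> exists f, sharp g x (differential f x) = w.
Proof.
move=> nd gP x w tw.
have [k u v tu tv|f wf] := @tangent_functional x (fun v => g x v w).
  exact: (metric_linear gR).
have [ts sf] := sharp_spec nd gP x f; exists f.
apply: (metric_representative_unique ts tw) => v tv.
by rewrite sf// -wf// (Defs.metric_sym gR).
Qed.

End Metric.

(** * Uniqueness of the metric and of its connection *)

(** The quotients apply the semigroups only to [f], [h] and [f * h], all smooth, so they agree for t
    > 0 and convergence carries over from [P'] to [P]. *)
Lemma eq_Gamma (P P' : R -> (M -> R) -> (M -> R)) : first_order_calculus P' ->
  (forall (t : R) (f : M -> R), 0 <= t -> smooth f -> P t f = P' t f) ->
  forall f h, Gamma P f h = Gamma P' f h.
Proof.
move=> calcP' PP' f h; apply/funext => x.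
have sf := cinf_smooth f; have sh := cinf_smooth h.
apply: cvg_lim => //; apply: cvg_trans (Gamma_cvg calcP' sf sh (x := x)).
apply: near_eq_cvg; near=> t.
have t0 : 0 <= t by apply: ltW; near: t; exact: nbhs_right_gt.
by rewrite /Gamma_quotient !PP'//; exact: smooth_mul.
Unshelve. all: by end_near. Qed.

(* Gamma f h x is the value at [f] of the gradient of [h], so Gamma determines
   gradients as derivations, hence the metric. *)
Lemma recovered_metric_unique (P P' : R -> (M -> R) -> (M -> R)) g g' :
  nondegenerate_Gamma P -> nondegenerate_Gamma P' ->
  recovered_metric P g -> recovered_metric P' g' ->
  (forall f h, Gamma P f h = Gamma P' f h) ->
  forall x u v, tangent x u -> tangent x v -> g x u v = g' x u v.
Proof.
move=> nd nd' gP gP' GG x u v tu tv.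
have gR := gP.1; have gR' := gP'.1.
have [f uE] := sharp_surjective gR nd gP tu.
have [ts sf] := sharp_spec gR nd gP x f.
have [ts' sf'] := sharp_spec gR' nd' gP' x f.
(* Each metric pairs its own gradient of [f] with [v] to give [v f]. *)
suff uE' : sharp g' x (differential f x) = u.
  by transitivity (v f); [rewrite -uE sf|rewrite -uE' sf'].
rewrite -uE; apply/funext => h.
have [tr sr] := sharp_spec gR nd gP x h.
have [tr' sr'] := sharp_spec gR' nd' gP' x h.
(* Each side of the equality of Gamma becomes a gradient of [f] applied to [h]. *)
have := gP.2 h f x; rewrite GG gP'.2 /dual_metric.
by rewrite sr// sr'.
Qed.

(* The difference of two Levi-Civita connections gives a trilinear form
   symmetric in its first two arguments and skew in its last two, hence zero. *)
Lemma levi_civita_unique g g' nabla nabla' : riemannian_metric g ->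
  (forall x u v, tangent x u -> tangent x v -> g x u v = g' x u v) ->
  levi_civita g nabla -> levi_civita g' nabla' ->
  forall X Y, vector_field X -> vector_field Y -> nabla X Y = nabla' X Y.
Proof.
move=> gR gg' LC LC' X Y vX vY.
pose D X Y : cinf M -> cinf M := nabla X Y - nabla' X Y.
have atD x X0 Y0 : at_point (D X0 Y0) x =
  at_point (nabla X0 Y0) x - at_point (nabla' X0 Y0) x by [].
have nf X0 Y0 x : vector_field X0 -> vector_field Y0 ->
    tangent x (at_point (nabla X0 Y0) x).
  by move=> vX0 vY0; exact: (nabla_field LC).
have nf' X0 Y0 x : vector_field X0 -> vector_field Y0 ->
    tangent x (at_point (nabla' X0 Y0) x).
  by move=> vX0 vY0; exact: (nabla_field LC').
have vD X0 Y0 : vector_field X0 -> vector_field Y0 -> vector_field (D X0 Y0).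
  by move=> vX0 vY0 x; rewrite atD; apply: tangentB; [exact: nf|exact: nf'].
have Dsym X0 Y0 : vector_field X0 -> vector_field Y0 -> D X0 Y0 = D Y0 X0.
  (* Both torsion identities have the same right-hand side, the Lie bracket, which involves no
     metric. *)
  move=> vX0 vY0; apply/eqP; rewrite /D subr_eq -addrA.
  rewrite [X in _ + X]addrC (nabla_torsion_free LC' vX0 vY0).
  by rewrite -(nabla_torsion_free LC vX0 vY0) addrC subrK.
have Dskew x X0 Y0 Z0 :
    vector_field X0 -> vector_field Y0 -> vector_field Z0 ->
    g x (at_point (D X0 Y0) x) (at_point Z0 x) =
    - g x (at_point (D X0 Z0) x) (at_point Y0 x).
  move=> vX0 vY0 vZ0.
  (* As the metrics agree, this one function enters both compatibility identities; comparing the two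
     formulas for [X0 k] gives skewness. *)
  pose k : cinf M := Cinf (introT (cinf_predP _) (metric_smooth gR vY0 vZ0)).
  have kE y : k y = g y (at_point Y0 y) (at_point Z0 y) by [].
  have kE' y : k y = g' y (at_point Y0 y) (at_point Z0 y) by rewrite kE gg'.
  have := nabla_metric LC vX0 vY0 vZ0 kE x.
  rewrite (nabla_metric LC' vX0 vY0 vZ0 kE' x).
  have [tYZ tZY] := (nf _ _ x vX0 vZ0, nf' _ _ x vX0 vZ0).
  have [tXY tYX] := (nf _ _ x vX0 vY0, nf' _ _ x vX0 vY0).
  rewrite -!gg'// !atD !(metricBl gR)//.
  rewrite ![g x (at_point Y0 x) _](Defs.metric_sym gR)//.
  by lra.
suff D0 : D X Y = 0 by exact: subr0_eq.
apply/funext => f; apply/val_inj/funext => x.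
suff : at_point (D X Y) x = 0 by move=> /(congr1 (@^~ f)).
have vXY := vD _ _ vX vY.
apply: (metric_eq0 gR (vXY x)).
(* [D X Y] is tested against itself; naming the second copy keeps the rewriting below on the
   first. *)
set Z := {2}(D X Y); have vZ : vector_field Z := vXY.
suff : g x (at_point (D X Y) x) (at_point Z x) =
    - g x (at_point (D X Y) x) (at_point Z x) by lra.
(* With T(X,Y,Z) = g(D X Y, Z): T(X,Y,Z) = -T(X,Z,Y) = -T(Z,X,Y) = T(Z,Y,X) = T(Y,Z,X) = -T(Y,X,Z) =
   -T(X,Y,Z). *)
rewrite {1}Dskew// (Dsym X Z)// Dskew// opprK (Dsym Z Y)// Dskew//.
by rewrite (Dsym Y X).
Qed.

End Smooth.

Theorem theorem4p4 (R : realType) (n : nat) (M : smooth_manifold R n)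
    (Mconn : connected [set: M])
    (mu mu' : {measure set (borel M) -> \bar R})
    (P P' : R -> (M -> R) -> (M -> R))
    (diffP : diffusion_axioms mu P) (diffP' : diffusion_axioms mu' P')
    (calcP : first_order_calculus P) (calcP' : first_order_calculus P')
    (ndP : nondegenerate_Gamma P) (ndP' : nondegenerate_Gamma P')
    (g g' : tensor2 M)
    (gP : recovered_metric P g) (gP' : recovered_metric P' g')
    (nabla nabla' : (cinf M -> cinf M) -> (cinf M -> cinf M) ->
                    (cinf M -> cinf M))
    (LC : levi_civita g nabla) (LC' : levi_civita g' nabla') :
  (forall (t : R) (f : M -> R), 0 <= t -> smooth f -> P t f = P' t f) ->
  forall X Y : cinf M -> cinf M, vector_field X -> vector_field Y ->
    nabla X Y = nabla' X Y.
Proof.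
move=> PP'; apply: (levi_civita_unique gP.1 _ LC LC').
exact: recovered_metric_unique ndP ndP' gP gP' (eq_Gamma calcP' PP').
Qed.
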